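(* Let $n\geq1$, let $A$ and $B$ be $n\times n$ matrices with entries in $\{-1,0,1\}$ such that $A_{ij}B_{ij}=0$ for all $i,j\in\{1,\dots,n\}$, and let $\omega=\exp(2\pi\mathbf{i}/3)$. If $H:=A\omega+B\omega^2\in\mathrm{BH}(n,6)$, then \[K:=A\otimes\begin{bmatrix}1&1\\1&-1\end{bmatrix}+B\otimes\begin{bmatrix}\mathbf{i}&-1\\-1&\mathbf{i}\end{bmatrix}\in\mathrm{BH}(2n,4).\]
   Context: For positive integers $n,q$, $\mathrm{BH}(n,q)$ denotes the set of $n\times n$ complex matrices all of whose entries are complex $q$th roots of unity and which satisfy $HH^\ast=nI_n$, where $H^\ast$ is the conjugate transpose and $I_n$ the identity. $\otimes$ denotes the Kronecker product and $\mathbf{i}$ the imaginary unit. *)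

(* Defs.v *)
From HB Require Import structures.
From mathcomp Require Import all_boot all_order all_algebra.
From mathcomp Require Import complex mxtens.
From mathcomp Require Import reals trigo.
From mathcomp Require Import sequences exp.

Set Implicit Arguments.
Unset Strict Implicit.
Unset Printing Implicit Defensive.

Import Order.TTheory GRing.Theory Num.Theory.
Local Open Scope ring_scope.
Local Open Scope complex_scope.
Local Open Scope sesquilinear_scope.

(* exp (x + i y) = e^x (cos y + i sin y) *)
Definition cexp (R : realType) (z : R[i]) : R[i] :=
  (expR (complex.Re z))%:C * (cos (complex.Im z) +i* sin (complex.Im z)).

Definition omega3 (R : realType) : R[i] := cexp (2 * pi%:C * 'i%C / 3).

Definition mx22 (T : nmodType) (a b c d : T) : 'M[T]_2 :=
  \matrix_(i < 2, j < 2) (nth [::] [:: [:: a; b]; [:: c; d]] i)`_j.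

(* H ^t* is the conjugate transpose *)
Definition BH (R : realType) (n q : nat) : {pred 'M[R[i]]_n} :=
  [pred H : 'M[R[i]]_n |
    [forall i, forall j, q.-unity_root (H i j)] &&
    (H *m H ^t* == n%:R%:M)].
Arguments BH R n q : clear implicits.

(* Main.v *)
Require Import Defs.
From HB Require Import structures.
From mathcomp Require Import all_boot all_order all_algebra.
From mathcomp Require Import complex mxtens.
From mathcomp Require Import reals trigo.
From mathcomp Require Import exp.
From mathcomp Require Import ring lra.
Import Order.TTheory GRing.Theory Num.Theory.
Local Open Scope ring_scope.
Local Open Scope complex_scope.

(* Since [A] and [B] are real, [H H^* = A A^T + B B^T + w^* A B^T + w B A^T].
   Comparing [H H^* = n I] with its complex conjugate gives [A B^T = B A^T],
   as [w] is not real, and then [A A^T + B B^T - A B^T = n I] since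
   [w + w^* = -1].  With [K = A (x) X + B (x) Y] one has
   [X X^* = Y Y^* = 2 I] and [X Y^* + Y X^* = -2 I], so that
   [K K^* = 2 (A A^T + B B^T - A B^T) (x) I]. *)

Local Open Scope sesquilinear_scope.

Lemma conjC_sign (C : numClosedFieldType) (x : C) :
  x \in [:: -1; 0; 1] -> (x^*)%R = x.
Proof.
by rewrite !inE => /or3P[] /eqP->; rewrite ?rmorphN ?rmorph0 ?rmorph1.
Qed.

Section RealTrigonometry.
Variable R : realType.
Let t : R := 2 * pi / 3.

(** Positivity serves twice: it allows cancelling the sine in a triple angle identity, and it shows
    that [omega3] is not real. *)
Lemma sin_2pi3_gt0 : 0 < sin t.
Proof. by apply: sin_gt0_pi; rewrite /t; have := pi_gt0 R; lra. Qed.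

(** Write [c], [s] for the cosine and sine of [t]. As 3t = 2 pi, the sine expansion gives s (4 c^2 -
    1) = 0, hence 4 c^2 = 1; the cosine expansion 4 c^3 - 3 c = 1 then becomes c - 3 c = 1. *)
Lemma cos_2pi3 : cos t = - 2^-1.
Proof.
have s_gt0 := sin_2pi3_gt0.
have e3 : t + t + t = pi *+ 2 by rewrite /t mulr2n; field.
have := sin2pi R; have := cos2pi R; rewrite -e3 !(cosD, sinD).
have := cos2Dsin2 t; move: s_gt0; set s := sin t; set c := cos t.
move=> s_gt0 cs hc hs.
have s2 : s ^+ 2 = 1 - c ^+ 2 by rewrite -cs; ring.
have c4 : 4 * c ^+ 2 = 1.
  apply/eqP; rewrite -subr_eq0 -(mulrI_eq0 _ (mulfI (lt0r_neq0 s_gt0))).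
  apply/eqP; rewrite -[RHS]hs -[in LHS]cs; ring: s2 cs.
have : c * (4 * c ^+ 2) - 3 * c = 1 by rewrite -[RHS]hc; ring: s2.
by rewrite c4; lra.
Qed.

End RealTrigonometry.

Section CubeRoot.
Variable R : realType.
Local Notation w := (omega3 R).
Local Notation wc := (Num.conj w).

Lemma omega3E : w = (- 2^-1) +i* sin (2 * pi / 3).
Proof.
have e : 2 * pi%:C * 'i%C / 3 = 0 +i* (2 * pi / 3) :> R[i].
  (* With the numerals seen as embedded reals, the quotient can be computed componentwise. *)
  have -> : 3 = 3%:C :> R[i] by rewrite rmorph_nat.
  have -> : 2 = 2%:C :> R[i] by rewrite rmorph_nat.
  rewrite -fmorphV; apply/eqP; rewrite eq_complex /=.
  by apply/andP; split; apply/eqP; ring.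
by rewrite /omega3 /cexp e /= expR0 mul1r cos_2pi3.
Qed.

Lemma omega3_conjD : w + wc = -1.
Proof.
rewrite omega3E; apply/eqP; rewrite eq_complex /=.
by apply/andP; split; apply/eqP; field.
Qed.

Lemma omega3_conjM : w * wc = 1.
Proof.
have := cos2Dsin2 (2 * pi / 3 : R); rewrite cos_2pi3 => h.
rewrite omega3E; apply/eqP; rewrite eq_complex /=.
by apply/andP; split; apply/eqP; [rewrite -[RHS]h|]; ring.
Qed.

Lemma omega3_nonreal : w - wc != 0.
Proof.
rewrite omega3E eq_complex /= negb_and; apply/orP; right.
by have := sin_2pi3_gt0 R; set s := sin _ => s0; apply/eqP => e; lra.
Qed.

End CubeRoot.

Section GramMatrices.
Variables (R : realType) (n : nat) (A B : 'M[R[i]]_n).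
Hypotheses (hA : forall i j, A i j \in [:: -1; 0; 1])
           (hB : forall i j, B i j \in [:: -1; 0; 1]).
Local Notation w := (omega3 R).
Local Notation wc := (Num.conj w).

Lemma conjmx_sign (M : 'M[R[i]]_n) :
  (forall i j, M i j \in [:: -1; 0; 1]) -> map_mx Num.conj M = M.
Proof. by move=> hM; apply/matrixP => i j; rewrite mxE conjC_sign. Qed.

Lemma gram_omega3 : (w *: A + w ^+ 2 *: B) *m (w *: A + w ^+ 2 *: B) ^t* =
  A *m A^T + B *m B^T + wc *: (A *m B^T) + w *: (B *m A^T).
Proof.
have ww : w * wc = 1 := omega3_conjM R.
rewrite linearD !linearZ /= map_mxD !map_mxZ -!map_trmx !conjmx_sign //.
rewrite mulmxDl !mulmxDr -!scalemxAl -!scalemxAr !scalerA rmorphXn /=.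
have -> : w * wc ^+ 2 = wc by rewrite expr2 mulrA ww mul1r.
have -> : w ^+ 2 * wc = w by rewrite expr2 -mulrA ww mulr1.
by rewrite -exprMn ww expr1n !scale1r [X in _ + X]addrC addrACA addrA.
Qed.

Hypothesis hH : (w *: A + w ^+ 2 *: B) *m (w *: A + w ^+ 2 *: B) ^t* = n%:R%:M.

Lemma cross_gram_sym : A *m B^T = B *m A^T.
Proof.
have h1 := gram_omega3; rewrite hH in h1.
(* Conjugation fixes [A], [B] and [n] and swaps [w] with [wc], so [h2] is [h1] with the two cross
   coefficients exchanged. *)
have h2 := congr1 (map_mx (Num.conj : R[i] -> R[i])) h1.
rewrite map_scalar_mx rmorph_nat !map_mxD !map_mxZ !map_mxM -!map_trmx in h2.
rewrite /= !conjmx_sign // conjCK in h2.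
set G := A *m A^T + _ in h1 h2; clearbody G.
have : (w - wc) *: (A *m B^T - B *m A^T) = 0.
  have : G + w *: (A *m B^T) + wc *: (B *m A^T) =
         G + wc *: (A *m B^T) + w *: (B *m A^T) by rewrite -h1 h2.
  rewrite -!addrA => /addrI/eqP; rewrite -subr_eq0 => /eqP <-.
  by rewrite scalerBr !scalerBl opprB opprD addrACA.
by move/eqP; rewrite scaler_eq0 (negPf (omega3_nonreal R)) subr_eq0 => /eqP.
Qed.

Lemma gram_sub_cross : A *m A^T + B *m B^T - A *m B^T = n%:R%:M.
Proof.
rewrite -hH gram_omega3 -cross_gram_sym -[RHS]addrA -scalerDl.
by rewrite [wc + w]addrC omega3_conjD scaleN1r.
Qed.

End GramMatrices.

Section TwoByTwo.
Variable R : realType.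
Local Notation X := (mx22 1 1 1 (-1) : 'M[R[i]]_2).
Local Notation Y := (mx22 'i%C (-1) (-1) 'i%C : 'M[R[i]]_2).

Lemma mx22_unity (i j : 'I_2) : X i j ^+ 4 = 1 /\ Y i j ^+ 4 = 1.
Proof.
have i4 : ('i%C : R[i]) ^+ 4 = 1 by rewrite (exprM _ 2 2) sqr_i sqrrN expr1n.
have m4 : (-1 : R[i]) ^+ 4 = 1 by rewrite (exprM _ 2 2) sqrrN !expr1n.
by rewrite !mxE; case: i => [[|[|]]] //= _; case: j => [[|[|]]] //= _;
  rewrite ?expr1n.
Qed.

Lemma mx22_gram_l : X *m X ^t* = 2%:M.
Proof.
apply/matrixP => i j; rewrite !mxE !big_ord_recl big_ord0 !mxE.
by case: i => [[|[|]]] //= ?; case: j => [[|[|]]] //= ?; apply/eqP;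
  rewrite eq_complex /=; apply/andP; split; apply/eqP; ring.
Qed.

Lemma mx22_gram_r : Y *m Y ^t* = 2%:M.
Proof.
apply/matrixP => i j; rewrite !mxE !big_ord_recl big_ord0 !mxE.
by case: i => [[|[|]]] //= ?; case: j => [[|[|]]] //= ?; apply/eqP;
  rewrite eq_complex /=; apply/andP; split; apply/eqP; ring.
Qed.

(** Up to the factor 2, [X] and [Y] satisfy the same relations as [w] and [w ^+ 2]: both of the
    latter have modulus 1, and w (w^2)^* + w^2 w^* = w^2 + w = -1. This is why they can replace them
    in [H]. *)
Lemma mx22_cross_gram : X *m Y ^t* + Y *m X ^t* = (-2)%:M.
Proof.
apply/matrixP => i j; rewrite !mxE !big_ord_recl !big_ord0 !mxE.
by case: i => [[|[|]]] //= ?; case: j => [[|[|]]] //= ?; apply/eqP;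
  rewrite eq_complex /=; apply/andP; split; apply/eqP; ring.
Qed.

End TwoByTwo.

Section TensorBilinear.
Variables (C : comPzRingType) (m n p q : nat).

Lemma tensmxDl (M N : 'M[C]_(m, n)) (P : 'M[C]_(p, q)) :
  (M + N) *t P = M *t P + N *t P.
Proof. by apply/matrixP => i j; rewrite !mxE mulrDl. Qed.

Lemma tensmxDr (M : 'M[C]_(m, n)) (P Q : 'M[C]_(p, q)) :
  M *t (P + Q) = M *t P + M *t Q.
Proof. by apply/matrixP => i j; rewrite !mxE mulrDr. Qed.

Lemma tensmxNl (M : 'M[C]_(m, n)) (P : 'M[C]_(p, q)) :
  (- M) *t P = - (M *t P).
Proof. by apply/matrixP => i j; rewrite !mxE mulNr. Qed.

Lemma tensmxNr (M : 'M[C]_(m, n)) (P : 'M[C]_(p, q)) :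
  M *t (- P) = - (M *t P).
Proof. by apply/matrixP => i j; rewrite !mxE mulrN. Qed.

Lemma tens_scalars (a b : C) : (a%:M : 'M_m) *t (b%:M : 'M_p) = (a * b)%:M.
Proof.
apply/matrixP => k l.
case: (mxtens_indexP k) => i i'; case: (mxtens_indexP l) => j j'.
(* The index encoding is injective on pairs, so an entry is diagonal exactly when both components
   agree. *)
rewrite tensmxE !mxE (can_eq (@mxtens_indexK _ _)) xpair_eqE.
by case: eqP; case: eqP; rewrite ?mulr0 ?mul0r.
Qed.

End TensorBilinear.

Theorem mainTheorem6 (R : realType) (n : nat) (A B : 'M[R[i]]_n)
  (hn : (1 <= n)%N)
  (hA : forall i j, A i j \in [:: -1; 0; 1])
  (hB : forall i j, B i j \in [:: -1; 0; 1])
  (hAB : forall i j, A i j * B i j = 0)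
  (hH : omega3 R *: A + omega3 R ^+ 2 *: B \in BH R n 6) :
  A *t mx22 1 1 1 (-1) + B *t mx22 'i%C (-1) (-1) 'i%C \in BH R (n * 2) 4.
Proof.
have /andP[/forallP Hunit /eqP Hgram] := hH.
have AB := cross_gram_sym _ _ _ _ hA hB Hgram.
have G := gram_sub_cross _ _ _ _ hA hB Hgram.
apply/andP; split; last first.
  apply/eqP; rewrite linearD /= !trmx_tens map_mxD !map_mxT.
  rewrite mulmxDl !mulmxDr !tensmx_mul mx22_gram_l mx22_gram_r.
  rewrite -[map_mx _ A^T]map_trmx (conjmx_sign _ _ _ hA).
  rewrite -[map_mx _ B^T]map_trmx (conjmx_sign _ _ _ hB) -AB.
  (* The two cross terms share the left factor [A *m B^T], so their right factors add up to -2 I.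
     Moving the sign to the left gives all three terms the right factor 2 I, and their left factors
     sum to n I by [G]. *)
  rewrite -addrA [X in _ + X]addrA -tensmxDr mx22_cross_gram [(-2)%:M]raddfN.
  rewrite tensmxNr -tensmxNl -!tensmxDl [- _ + _]addrC addrA G.
  by rewrite tens_scalars natrM.
have sign4 (x : R[i]) : x \in [:: -1; 0; 1] -> x != 0 -> x ^+ 4 = 1.
  rewrite !inE => /or3P[] /eqP-> => [_ | /eqP// | _]; last exact: expr1n.
  by rewrite (exprM _ 2 2) sqrrN !expr1n.
apply/'forall_forallP => k l.
case: (mxtens_indexP k) => i a; case: (mxtens_indexP l) => j b.
rewrite mxE !tensmxE unity_rootE.
have [X4 Y4] := mx22_unity R a b.
have H6 := forallP (Hunit i) j; rewrite unity_rootE !mxE in H6.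
(* Exactly one of [A i j] and [B i j] is nonzero, so the entry of [K] is a sign times an entry of
   [X] or [Y]. They cannot both vanish, since 0 is not a sixth root of unity. *)
have [A0 | A_neq0] := eqVneq (A i j) 0.
  have B_neq0 : B i j != 0.
    apply: contraL H6 => /eqP->; rewrite A0 !mulr0 addr0 expr0n /=.
    by rewrite eq_sym oner_eq0.
  by rewrite A0 mul0r add0r exprMn sign4 // mul1r; exact/eqP.
have /eqP := hAB i j; rewrite mulf_eq0 (negPf A_neq0) => /eqP ->.
by rewrite mul0r addr0 exprMn sign4 // mul1r; exact/eqP.
Qed.
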